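(* Let $\tilde b_i=\langle(a_i,b_i,c_i);\mu_i^-,\mu_i^+\rangle$, $i=1,2,3$, be three G-PDMFs in $X_{h,p}$. Then for all $\lambda,\lambda_1,\lambda_2\in\mathbb{R}$: (1) $\tilde b_1\oplus\tilde b_2=\tilde b_2\oplus\tilde b_1$ and $(\tilde b_1\oplus\tilde b_2)\oplus\tilde b_3=\tilde b_1\oplus(\tilde b_2\oplus\tilde b_3)$; (2) $\tilde b_1\ominus\tilde b_2=-(\tilde b_2\ominus\tilde b_1)$ and $(\tilde b_1\ominus\tilde b_2)\ominus\tilde b_3=\tilde b_1\ominus(\tilde b_2\oplus\tilde b_3)$; (3) $\lambda(\tilde b_1\oplus\tilde b_2)=\lambda\tilde b_1\oplus\lambda\tilde b_2$ for all $\lambda\in\mathbb{R}$; (4) $\lambda_1\tilde b_1\oplus\lambda_2\tilde b_1=(\lambda_1+\lambda_2)\tilde b_1$ for all $\lambda_1,\lambda_2\in\mathbb{R}$ with $\lambda_1\lambda_2\ge0$; (5) $\tilde b_1\oplus(-1)\tilde b_2=\tilde b_1\ominus\tilde b_2$.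
   Context: Let $h(x)=\tan(\pi x-\frac{\pi}{2})$ for $x\in(0,1)$ and $p(t;\mu)=\frac{1}{\sqrt{2\pi}}e^{-\frac12(t-\mu)^2}$ for $t,\mu\in\mathbb{R}$. A Gaussian probability density membership function (G-PDMF) is denoted $\langle(a,b,c);\mu^-,\mu^+\rangle$ with real parameters $a\le b\le c$ and $\mu^-,\mu^+\in\mathbb{R}$; it represents the membership function $f:\mathbb{R}\to[0,1]$ with $f(b)=1$, $f(x)=\int_{-\infty}^{h((x-a)/(b-a))}p(t;\mu^-)\,dt$ for $x\in(a,b)$, $f(x)=\int_{-\infty}^{h((c-x)/(c-b))}p(t;\mu^+)\,dt$ for $x\in(b,c)$, and $f(x)=0$ for all other $x$. The Gaussian PDMF space $X_{h,p}$ is the set of all G-PDMFs $\langle(a,b,c);\mu^-,\mu^+\rangle$; a G-PDMF is given by its parameters, and operations and equalities between G-PDMFs are understood in terms of these parameters. Operations: for $\tilde b_i=\langle(a_i,b_i,c_i);\mu_i^-,\mu_i^+\rangle$, $i=1,2$, and $\lambda\in\mathbb{R}$, (1) $\tilde b_1\oplus\tilde b_2=\langle(a_1+a_2,b_1+b_2,c_1+c_2);\mu_1^-+\mu_2^-,\mu_1^++\mu_2^+\rangle$; (2) $\lambda\tilde b_1=\langle(\lambda a_1,\lambda b_1,\lambda c_1);\lambda\mu_1^-,\lambda\mu_1^+\rangle$ if $\lambda\ge0$, and $\lambda\tilde b_1=\langle(\lambda c_1,\lambda b_1,\lambda a_1);\lambda\mu_1^+,\lambda\mu_1^-\rangle$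 if $\lambda<0$; (3) $\tilde b_1\ominus\tilde b_2=\langle(a_1-c_2,b_1-b_2,c_1-a_2);\mu_1^--\mu_2^+,\mu_1^+-\mu_2^-\rangle$. The notation $-\tilde b$ means $(-1)\tilde b$. *)

(* Defs.v *)
From HB Require Import structures.
From mathcomp Require Import all_boot all_order all_algebra.
From mathcomp Require Import all_classical all_reals all_analysis.

Set Implicit Arguments.
Unset Strict Implicit.
Unset Printing Implicit Defensive.

Import Order.TTheory GRing.Theory Num.Theory.

Local Open Scope classical_set_scope.
Local Open Scope ring_scope.

Declare Scope gpdmf_scope.
Delimit Scope gpdmf_scope with gpdmf.

(* <(a, b, c); mu^-, mu^+>. The order constraints are boolean, hence
   proof-irrelevant: Leibniz equality is equality of the five parameters
   (lemma gpdmf_eqP below). *)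
Record gpdmf (R : realType) := GPDMF {
  pa : R;
  pb : R;
  pc : R;
  mu_l : R;
  mu_r : R;
  pa_le_pb : pa <= pb;
  pb_le_pc : pb <= pc }.

Bind Scope gpdmf_scope with gpdmf.

Lemma gpdmf_eqP (R : realType) (x y : gpdmf R) :
  x = y <-> [/\ pa x = pa y, pb x = pb y, pc x = pc y,
                mu_l x = mu_l y & mu_r x = mu_r y].
Proof.
split=> [-> //|]; case: x y => [a b c m n ab bc] [a' b' c' m' n' ab' bc'] /=.
case=> ea eb ec em en; subst.
by rewrite (bool_irrelevance ab ab') (bool_irrelevance bc bc').
Qed.

Section Membership.
Variable R : realType.
Implicit Types (x : gpdmf R) (s t m u : R).

Definition h_tan s : R := tan (pi * s - pi / 2).

Definition p_gauss t m : R :=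
  (Num.sqrt (2 * pi))^-1 * expR (- (2^-1 * (t - m) ^+ 2)).

Definition gauss_cdf m u : R :=
  Rintegral lebesgue_measure `]-oo, u] (fun t => p_gauss t m).

Definition membership x u : R :=
  if u == pb x then 1
  else if pa x < u < pb x then
    gauss_cdf (mu_l x) (h_tan ((u - pa x) / (pb x - pa x)))
  else if pb x < u < pc x then
    gauss_cdf (mu_r x) (h_tan ((pc x - u) / (pc x - pb x)))
  else 0.

End Membership.

Section Operations.
Variable R : realType.
Implicit Types (x y : gpdmf R) (l : R).

Definition gadd x y : gpdmf R :=
  GPDMF (mu_l x + mu_l y) (mu_r x + mu_r y)
    (lerD (pa_le_pb x) (pa_le_pb y))
    (lerD (pb_le_pc x) (pb_le_pc y)).

Definition gsub x y : gpdmf R :=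
  GPDMF (mu_l x - mu_r y) (mu_r x - mu_l y)
    (lerB (pa_le_pb x) (pb_le_pc y))
    (lerB (pb_le_pc x) (pa_le_pb y)).

Definition gscale_ge0 l (l0 : 0 <= l) x : gpdmf R :=
  GPDMF (l * mu_l x) (l * mu_r x)
    (ler_wpM2l l0 (pa_le_pb x))
    (ler_wpM2l l0 (pb_le_pc x)).

Definition gscale_le0 l (l0 : l <= 0) x : gpdmf R :=
  GPDMF (l * mu_r x) (l * mu_l x)
    (ler_wnM2l l0 (pb_le_pc x))
    (ler_wnM2l l0 (pa_le_pb x)).

Lemma Nge0_le0 l : ~ 0 <= l -> l <= 0.
Proof. by move/negP; rewrite -ltNge => /ltW. Qed.

Definition gscale l x : gpdmf R :=
  match decP (@idP (0 <= l)) with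
  | left l0 => gscale_ge0 l0 x
  | right l0 => gscale_le0 (Nge0_le0 l0) x
  end.

Definition gopp x : gpdmf R := gscale (-1) x.

End Operations.

Notation "x \oplus y" := (gadd x y)
  (at level 50, left associativity) : gpdmf_scope.
Notation "x \ominus y" := (gsub x y)
  (at level 50, left associativity) : gpdmf_scope.
Notation "l \scale x" := (gscale l%R x)
  (at level 40, x at level 35, no associativity) : gpdmf_scope.
Notation "- x" := (gopp x) : gpdmf_scope.

(* Main.v *)
Require Import Defs.
From mathcomp Require Import all_boot all_order all_algebra.
From mathcomp Require Import all_classical all_reals all_analysis.
From mathcomp Require Import ring.

Import Order.TTheory GRing.Theory Num.Theory.

(** By [gpdmf_eqP] each equality reduces to five identities between real parameters, which [ring]
    settles once every [gscale] has a known branch. A negative scalar swaps left and right data, so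
    only signs matter: [gscale_ge0E] and [gscale_le0E] fix the branch, both covering the scalar
    0. *)

(** Boolean proof irrelevance lets any given [l0] replace the proof that [decP] yields. *)
Lemma gscale_ge0E (R : realType) (l : R) (l0 : (0 <= l)%R) (x : gpdmf R) :
  gscale l x = gscale_ge0 l0 x.
Proof.
rewrite /gscale; case: decP => [l0'|/(_ l0)//].
by rewrite (bool_irrelevance l0' l0).
Qed.

(* At l = 0 [gscale] takes the nonnegative branch; the two branches agree. *)
Lemma gscale_le0E (R : realType) (l : R) (l0 : (l <= 0)%R) (x : gpdmf R) :
  gscale l x = gscale_le0 l0 x.
Proof.
rewrite /gscale; case: decP => [l0'|nl0]; last first.
  by rewrite (bool_irrelevance (Nge0_le0 nl0) l0).
have lE : l = 0%R by apply/eqP; rewrite eq_le l0 l0'.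
by apply/gpdmf_eqP; split=> /=; rewrite lE !mul0r.
Qed.

Lemma mulr_ge0_same_sign (R : realDomainType) (x y : R) :
  (0 <= x * y)%R -> (0 <= x)%R /\ (0 <= y)%R \/ (x <= 0)%R /\ (y <= 0)%R.
Proof.
move=> xy0; have [x0|x0|x0] := ltrgtP x 0%R.
- by right; split=> //; rewrite -(nmulr_rge0 y x0).
- by left; split=> //; rewrite -(pmulr_rge0 y x0).
(* Here [x] is 0, which fits either side, so the sign of [y] decides. *)
- by case: (leP 0%R y) => [|/ltW]; [left | right].
Qed.

Theorem theorem4p3 (R : realType) (b1 b2 b3 : gpdmf R) (l l1 l2 : R) :
  [/\ (b1 \oplus b2 = b2 \oplus b1)%gpdmf /\
      ((b1 \oplus b2) \oplus b3 = b1 \oplus (b2 \oplus b3))%gpdmf,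
      (b1 \ominus b2 = - (b2 \ominus b1))%gpdmf /\
      ((b1 \ominus b2) \ominus b3 = b1 \ominus (b2 \oplus b3))%gpdmf,
      (l \scale (b1 \oplus b2) = l \scale b1 \oplus l \scale b2)%gpdmf,
      (0 <= l1 * l2)%R ->
        (l1 \scale b1 \oplus l2 \scale b1 = (l1 + l2) \scale b1)%gpdmf
    & (b1 \oplus (-1) \scale b2 = b1 \ominus b2)%gpdmf].
Proof.
have N10 : (-1 <= 0 :> R)%R by rewrite oppr_le0.
split.
- by split; apply/gpdmf_eqP; split=> /=; ring.
(* Scaling by -1 makes the same left-right swap that [gsub] builds in. *)
- by rewrite /gopp (gscale_le0E _ _ N10); split; apply/gpdmf_eqP; split=> /=; ring.
- case: (leP 0%R l) => [l0|/ltW l0].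
    by rewrite !(gscale_ge0E _ _ l0); apply/gpdmf_eqP; split=> /=; ring.
  by rewrite !(gscale_le0E _ _ l0); apply/gpdmf_eqP; split=> /=; ring.
(* With a common sign, [l1], [l2] and [l1 + l2] all take the same branch; with opposite signs only
   one summand would be swapped. *)
- case/mulr_ge0_same_sign=> -[l10 l20].
    rewrite (gscale_ge0E _ _ l10) (gscale_ge0E _ _ l20).
    rewrite (gscale_ge0E _ _ (addr_ge0 l10 l20)).
    by apply/gpdmf_eqP; split=> /=; ring.
  have l12 : (l1 + l2 <= 0)%R by rewrite -oppr_ge0 opprD addr_ge0 ?oppr_ge0.
  rewrite (gscale_le0E _ _ l10) (gscale_le0E _ _ l20) (gscale_le0E _ _ l12).
  by apply/gpdmf_eqP; split=> /=; ring.
- by rewrite (gscale_le0E _ _ N10); apply/gpdmf_eqP; split=> /=; ring.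
Qed.
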